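(* Let $K\geq 1$ be an integer and let $F:[0,\infty)^K\to[0,\infty)$ be Borel measurable. Then $F$ is a generalised e-merging function if, and only if, there is a $K$-tuple $\mathbf w=(w_1,\dots,w_K)\in[0,1]^K$ such that $\sum_{k=1}^K w_k\leq 1$ and, for every $\mathbf u=(u_1,\dots,u_K)\in[0,\infty)^K$, $$F(\mathbf u)\leq 1+\sum_{k=1}^K w_k(u_k-1).$$ In particular, every generalised e-merging function is dominated by a (monotone) e-merging function, that is, for every generalised e-merging function $F:[0,\infty)^K\to[0,\infty)$ there is an e-merging function $G:[0,\infty)^K\to[0,\infty)$ with $F(\mathbf u)\leq G(\mathbf u)$ for all $\mathbf u\in[0,\infty)^K$.
   Context: Given a measurable space $\mathcal X$ and a collection $\mathcal H$ of probability measures on $\mathcal X$ (the null hypothesis), an e-variable for $\mathcal H$ is a non-negative measurable function $E:\mathcal X\to[0,\infty)$ such that $\mathbb E_P[E]\leq 1$ for every $P\in\mathcal H$. For an integer $K\geq 1$, a generalised e-merging function is a Borel measurable mapping $F:[0,\infty)^K\to[0,\infty)$ (not assumed monotone) such that, for any measurable space $\mathcal X$, any collection $\mathcal H$ of probability measures on $\mathcal X$, and any $K$-tuple $\mathbf E=(E_1,\dots,E_K)$ of e-variables for $\mathcal H$, the composition $F\circ\mathbf E:x\mapsto F(E_1(x),\dots,E_K(x))$ is again an e-variable for $\mathcal H$. An e-merging function is a component-wise non-decreasing mapping $F:[0,\infty)^K\to[0,\infty)$ such that, for any measurable space $\mathcal X$, any collection $\mathcal H$ of probability measures on $\mathcal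 X$, and any $K$-tuple $\mathbf E=(E_1,\dots,E_K)$ of e-variables for $\mathcal H$, the composition $F\circ\mathbf E$ is again an e-variable for $\mathcal H$. *)

(* Defs.v *)
From HB Require Import structures.
From mathcomp Require Import all_boot all_order all_algebra.
From mathcomp Require Import all_classical all_reals all_analysis.

Set Implicit Arguments.
Unset Strict Implicit.
Unset Printing Implicit Defensive.

Import Order.TTheory GRing.Theory Num.Theory.
Import numFieldNormedType.Exports.

Local Open Scope classical_set_scope.
Local Open Scope ring_scope.

(* A map [0, oo)^K -> [0, oo) is encoded as a function K.-tuple R -> R of which
   only the restriction to the orthant matters: every condition below,
   including non-negativity and measurability, is relative to the orthant. *)
Definition orthant (R : realType) (K : nat) : set (K.-tuple R) :=
  [set u | forall k : 'I_K, 0 <= tnth u k].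

(* measurable_fun D f is an implication from the measurability of D; this lemma
   shows that the measurability of a function on the orthant is not vacuous. *)
Lemma measurable_orthant (R : realType) (K : nat) :
  measurable (@orthant R K).
Proof.
have -> : @orthant R K =
    \bigcap_(k in setT) ((fun u => tnth u k) @^-1` [set` `[0%R, +oo[%R]).
  apply/seteqP; split => u /= h k.
    by move=> _ /=; rewrite in_itv /= andbT; apply: h.
  by have := h k I; rewrite /= in_itv /= andbT.
apply: fin_bigcap_measurable => // k _.
rewrite -[X in measurable X]setTI; exact: measurable_tnth.
Qed.

Definition nonneg_on_orthant (R : realType) (K : nat) (F : K.-tuple R -> R)
    : Prop :=
  forall u, orthant u -> 0 <= F u.

(* K.-tuple R carries the product of the Borel sigma-algebras on R, which is
   the Borel sigma-algebra of R^K. *)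
Definition borel_on_orthant (R : realType) (K : nat) (F : K.-tuple R -> R)
    : Prop :=
  measurable_fun (@orthant R K) F.

Definition nondecreasing_on_orthant (R : realType) (K : nat)
    (F : K.-tuple R -> R) : Prop :=
  forall u v, orthant u -> orthant v ->
    (forall k : 'I_K, tnth u k <= tnth v k) -> F u <= F v.

(* The expectation takes values in \bar R, so the bound by 1 also asserts that
   it is finite. *)
Definition evariable (R : realType) (d : measure_display)
    (X : measurableType d) (H : set (probability X R)) (E : X -> R) : Prop :=
  [/\ forall x, 0 <= E x,
      measurable_fun setT E &
      forall P : probability X R, H P -> ('E_P[E] <= 1)%E].

Definition preserves_evariables (R : realType) (K : nat)
    (F : K.-tuple R -> R) : Prop :=
  forall (d : measure_display) (X : measurableType d)
         (H : set (probability X R)) (E : 'I_K -> X -> R),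
    (forall k, evariable H (E k)) ->
    evariable H (fun x => F [tuple E k x | k < K]).

Definition generalised_emerging (R : realType) (K : nat)
    (F : K.-tuple R -> R) : Prop :=
  [/\ nonneg_on_orthant F, borel_on_orthant F & preserves_evariables F].

Definition emerging (R : realType) (K : nat) (F : K.-tuple R -> R) : Prop :=
  [/\ nonneg_on_orthant F, nondecreasing_on_orthant F &
      preserves_evariables F].

(* Main.v *)
(* Finitely supported laws with all coordinate means equal to 1 already force
   the affine bound: they show that the convex cone generated by the points
   (u - 1, F u - 1) contains no (0, a) with a > 0. Since the perturbations
   u = 1 +- e_k of the point 1 lie in the orthant, this cone admits a
   non-vertical supporting hyperplane at the origin, whose slopes are the w_k.
   Non-negativity of F far along the k-th axis gives w_k >= 0, and at u = 0 it
   gives sum_k w_k <= 1. *)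
Require Import Defs.
From HB Require Import structures.
From mathcomp Require Import all_boot all_order all_algebra.
From mathcomp Require Import all_classical all_reals all_analysis.
From mathcomp Require Import measurable_realfun ring lra.

Set Implicit Arguments.
Unset Strict Implicit.
Unset Printing Implicit Defensive.

Import Order.TTheory GRing.Theory Num.Theory.
Import numFieldNormedType.Exports.

Local Open Scope classical_set_scope.
Local Open Scope ring_scope.

(** * Supporting hyperplanes of convex cones in finite dimension *)

(* The slopes are chosen one coordinate at a time, as in the Hahn-Banach
   theorem: w is correct on the cone elements whose coordinates from j on vanish,
   and the j-th slope is the supremum of the lower bounds coming from the
   elements with j-th coordinate 1. *)
Lemma cone_support (R : realType) (K : nat) (C : set ('rV[R]_K * R)) :
  (forall p q, C p -> C q -> C (p.1 + q.1, p.2 + q.2)) ->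
  (forall c p, 0 < c -> C p -> C (c *: p.1, c * p.2)) ->
  (forall k, exists a, C (delta_mx 0 k, a)) ->
  (forall k, exists a, C (- delta_mx 0 k, a)) ->
  (forall a, C (0, a) -> a <= 0) ->
  exists w : 'I_K -> R, forall p, C p -> p.2 <= \sum_k w k * p.1 0 k.
Proof.
move=> CD CZ Cpos Cneg C0.
suff H j : (j <= K)%N -> exists w : 'I_K -> R, forall p, C p ->
    (forall k : 'I_K, (j <= k)%N -> p.1 0 k = 0) ->
    p.2 <= \sum_k w k * p.1 0 k.
  have [w hw] := H K (leqnn K); exists w => p Cp; apply: hw => // k.
  by rewrite leqNgt ltn_ord.
elim: j => [_|j IH jK].
  exists (fun=> 0) => -[v a] Cp /= v0.
  rewrite big1 => [|k _]; last by rewrite mul0r.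
  suff v_eq0 : v = 0 by apply: C0; rewrite -v_eq0.
  by apply/rowP => k; rewrite mxE v0.
have [w hw] := IH (ltnW jK).
pose k0 := Ordinal jK.
pose L (v : 'rV[R]_K) := \sum_k w k * v 0 k.
have LD u v : L (u + v) = L u + L v.
  by rewrite -big_split; apply: eq_bigr => k _; rewrite mxE mulrDr.
have LZ c v : L (c *: v) = c * L v.
  by rewrite mulr_sumr; apply: eq_bigr => k _; rewrite mxE mulrCA.
pose supp (v : 'rV[R]_K) := forall k : 'I_K, (j < k)%N -> v 0 k = 0.
pose A := [set x | exists p, [/\ C p, supp p.1, p.1 0 k0 = 1 & x = p.2 - L p.1]].
have supp_delta : supp (delta_mx 0 k0).
  by move=> k jk; rewrite mxE eqxx -val_eqE /= gtn_eqF.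
(* An element with [k0]-th coordinate 1 plus one with -1 has that coordinate 0, so [w] already
   controls the sum. Hence each lower bound on the new slope lies below each upper bound. *)
have Aub q : C q -> supp q.1 -> q.1 0 k0 = -1 -> ubound A (L q.1 - q.2).
  move=> Cq sq q0 _ [p [Cp sp p0 ->]].
  have := hw _ (CD _ _ Cp Cq) => /=; rewrite -/(L _) LD => h.
  suff : p.2 + q.2 <= L p.1 + L q.1 by lra.
  apply: h => k; rewrite leq_eqVlt => /predU1P[kj|jk].
    have -> : k = k0 by apply/val_inj.
    by rewrite mxE p0 q0 subrr.
  by rewrite mxE sp ?sq ?addr0.
have A0 : A !=set0.
  have [a Ca] := Cpos k0.
  by exists (a - L (delta_mx 0 k0)), (delta_mx 0 k0, a); split; rewrite //= mxE !eqxx.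
have Ahas : has_ubound A.
  have [a Ca] := Cneg k0; exists (L (- delta_mx 0 k0) - a).
  apply: (Aub (- delta_mx 0 k0, a)) => //=; last by rewrite !mxE !eqxx.
  by move=> k jk; rewrite mxE supp_delta ?oppr0.
(* [A] collects defects relative to [L], which already includes the inherited value [w k0]; so
   [sup A] is a correction added to that value. *)
exists (fun k => w k + sup A * (k == k0)%:R) => -[v a] Cp /= sp.
have -> : \sum_k (w k + sup A * (k == k0)%:R) * v 0 k = L v + sup A * v 0 k0.
  under eq_bigr do rewrite mulrDl.
  rewrite big_split /=; congr (_ + _).
  rewrite (bigD1 k0) //= eqxx mulr1 big1 ?addr0 // => k /negbTE ->.
  by rewrite mulr0 mul0r.
have suppZ c : supp (c *: v) by move=> k jk; rewrite mxE sp ?mulr0.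
(* Rescaling makes a non-zero [k0]-th coordinate 1 or -1: the first case gives a member of [A], the
   second an upper bound by [Aub]. *)
have [v0|v0|v0] := ltrgt0P (v 0 k0).
- have := ub_le_sup Ahas (x := (v 0 k0)^-1 * a - L ((v 0 k0)^-1 *: v)).
  rewrite LZ -mulrBr mulrC ler_pdivrMr // => h.
  rewrite addrC -lerBlDr; apply: h.
  exists ((v 0 k0)^-1 *: v, (v 0 k0)^-1 * a); split => //=.
  + by apply: (CZ _ (v, a)); rewrite ?invr_gt0.
  + by rewrite mxE mulVf ?gt_eqF.
  + by rewrite LZ; ring.
- have nv0 : 0 < - v 0 k0 by lra.
  have Cn := CZ (- v 0 k0)^-1 (v, a).
  rewrite /= invr_gt0 in Cn.
  have := ge_sup A0 (Aub _ (Cn nv0 Cp) (suppZ _) _).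
  rewrite /= LZ mxE -mulrBr [_^-1 * (_ - _)]mulrC ler_pdivlMr // => h.
  suff : sup A * - v 0 k0 <= L v - a by lra.
  by apply: h; rewrite invrN mulNr mulVf ?lt_eqF.
- rewrite v0 mulr0 addr0; apply: (hw (v, a)) => //= k.
  rewrite leq_eqVlt => /predU1P[kj|/sp //].
  by have -> : k = k0 by apply/val_inj.
Qed.

(** * Finitely supported laws as test hypotheses *)

(* The sample space nat carries the discrete sigma-algebra, hence f needs no
   measurability hypothesis. *)
Lemma finite_probability (R : realType) (n : nat) (p : nat -> {nonneg R}) :
  \sum_(i < n) (p i)%:num = 1 ->
  exists P : probability nat R, forall f : nat -> R, (forall i, 0 <= f i) ->
    'E_P[f]%E = (\sum_(i < n) (p i)%:num * f i)%:E.
Proof.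
move=> p1.
pose m i : {measure set nat -> \bar R} := mscale (p i) (\d_i).
have mu1 : msum m n setT = 1%E.
  rewrite /msum -p1 -sumEFin; apply: eq_bigr => i _.
  by rewrite /m /= /mscale /= diracT mule1.
pose isP := Measure_isProbability.Build _ _ _ (msum m n) mu1.
pose P : probability nat R := HB.pack (msum m n) isP.
exists P => f f0.
rewrite unlock -[LHS]/(\int[msum m n]_x (f x)%:E)%E.
rewrite ge0_integral_measure_sum //; last by move=> x _; rewrite lee_fin.
rewrite -sumEFin; apply: eq_bigr => i _.
rewrite ge0_integral_mscale //; last by move=> x _; rewrite lee_fin.
by rewrite integral_dirac // diracT mul1e EFinM.
Qed.

(** Dividing the weights by their total [c] gives a law on the indices of [s]. Centring says that
    each coordinate has mean 1 under it, hence is an e-variable for this single law, and so [F] has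
    mean at most 1. If [c] is 0, all weights vanish. *)
Lemma emerging_conic_combination (R : realType) (K : nat) (F : K.-tuple R -> R)
    (s : seq (R * K.-tuple R)) :
  preserves_evariables F ->
  (forall x, x \in s -> 0 <= x.1 /\ orthant x.2) ->
  (forall k, \sum_(x <- s) x.1 * (tnth x.2 k - 1) = 0) ->
  \sum_(x <- s) x.1 * (F x.2 - 1) <= 0.
Proof.
move=> pF s0 centred.
(* The default has weight 0 and lies in the orthant, so the coordinates are non-negative on all of
   [nat], as e-variables must be. *)
pose x0 : R * K.-tuple R := (0, [tuple 0 | k < K]).
pose x i := nth x0 s i.
have x_ge0 i : 0 <= (x i).1 /\ orthant (x i).2.
  rewrite /x; have [si|si] := ltnP i (size s); first exact/s0/mem_nth.
  by rewrite nth_default //; split => // k; rewrite tnth_mktuple.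
pose c := \sum_(y <- s) y.1.
have c_ge0 : 0 <= c by rewrite /c big_seq sumr_ge0 // => y /s0[].
have sumB g : \sum_(y <- s) y.1 * (g y.2 - 1) = \sum_(y <- s) y.1 * g y.2 - c.
  by rewrite -sumrB; apply: eq_bigr => y _; rewrite mulrBr mulr1.
rewrite sumB; have [c0|c_neq0] := eqVneq c 0.
  rewrite c0 subr0 big_seq big1 // => y ys.
  move: c0 => /eqP; rewrite /c big_seq psumr_eq0 => [/allP h|z /s0[]//].
  by have := h y ys; rewrite ys /= => /eqP ->; rewrite mul0r.
have c_gt0 : 0 < c by rewrite lt0r c_neq0.
pose p i : {nonneg R} := NngNum (divr_ge0 (x_ge0 i).1 c_ge0).
have sump g : \sum_(i < size s) (p i)%:num * g (x i).2 =
    (\sum_(y <- s) y.1 * g y.2) / c.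
  rewrite (big_nth x0) big_mkord mulr_suml; apply: eq_bigr => i _ /=.
  by rewrite mulrAC.
have [|P EP] := @finite_probability R (size s) p.
  have := sump (fun=> 1); under eq_bigr do rewrite mulr1; move=> ->.
  by under eq_bigr do rewrite mulr1; rewrite divff.
have evE k : evariable [set P] (fun i => tnth (x i).2 k).
  split => [i||_ ->] //; first exact: (x_ge0 i).2.
  rewrite EP => [|i]; last exact: (x_ge0 i).2.
  rewrite lee_fin (sump (fun u => tnth u k)) ler_pdivrMr // mul1r.
  by rewrite -subr_le0 -(sumB (fun u => tnth u k)) centred.
have [FE0 _ /(_ P erefl)] := pF _ _ _ _ evE.
rewrite EP // lee_fin (sump (fun u => F [tuple tnth u k | k < K])).
rewrite ler_pdivrMr // mul1r -subr_le0.
have tupleK u : [tuple tnth u k | k < K] = u :> K.-tuple R.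
  by apply: eq_from_tnth => k; rewrite tnth_mktuple.
by under eq_bigr do rewrite tupleK.
Qed.

(** * Sufficiency of the affine bound *)

Lemma affine_preserves_evariables (R : realType) (K : nat)
    (F : K.-tuple R -> R) (w : K.-tuple R) :
  nonneg_on_orthant F -> borel_on_orthant F ->
  (forall k, 0 <= tnth w k) -> \sum_(k < K) tnth w k <= 1 ->
  (forall u, orthant u -> F u <= 1 + \sum_(k < K) tnth w k * (tnth u k - 1)) ->
  preserves_evariables F.
Proof.
move=> F0 mF w0 w1 Fw d X H E evE.
have E0 k x : 0 <= E k x by have [] := evE k.
have mE k : measurable_fun setT (E k) by have [] := evE k.
have oE x : orthant [tuple E k x | k < K] by move=> k; rewrite tnth_mktuple.
have mFE : measurable_fun setT (fun x => F [tuple E k x | k < K]).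
  apply: (@measurable_comp _ _ _ _ _ _ (@orthant R K) F setT) => //.
  - exact: measurable_orthant.
  - by move=> _ [x _ <-].
  - apply/measurable_fun_tnthP => k.
    by apply: (eq_measurable_fun (E k)) => // x _ /=; rewrite tnth_mktuple.
split => [x||P HP]; [exact: F0|exact: mFE|].
(* Regrouped as [r] plus the sum of the [w_k u_k], the bound has only non-negative terms, so its
   integral splits without any integrability condition. *)
pose r := 1 - \sum_(k < K) tnth w k.
have r0 : 0 <= r by rewrite subr_ge0.
apply: (@le_trans _ _ (\int[P]_x (r%:E + \sum_(k < K) (tnth w k)%:E * (E k x)%:E))%E).
  rewrite unlock; apply: ge0_le_integral => //.
  - by move=> x _; rewrite lee_fin F0.
  - exact/measurable_EFinP.
  - apply: emeasurable_funD => //; apply: emeasurable_sum => k.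
    exact/measurable_EFinP/measurable_funM.
  - move=> x _; under eq_bigr do rewrite -EFinM.
    rewrite sumEFin -EFinD lee_fin; apply: (le_trans (Fw _ (oE x))).
    under eq_bigr do rewrite tnth_mktuple mulrBr mulr1.
    by rewrite sumrB /r; lra.
rewrite ge0_integralD //; last 2 first.
- by move=> x _; apply: sume_ge0 => k _; rewrite -EFinM lee_fin mulr_ge0.
- by apply: emeasurable_sum => k; exact/measurable_EFinP/measurable_funM.
rewrite integral_cst //= probability_setT mule1.
rewrite ge0_integral_sum //; last 2 first.
- by move=> k; exact/measurable_EFinP/measurable_funM.
- by move=> k x _; rewrite -EFinM lee_fin mulr_ge0.
apply: (@le_trans _ _ (r%:E + \sum_(k < K) (tnth w k)%:E)%E).
  apply: leeD => //; apply: lee_sum => k _.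
  rewrite ge0_integralZl_EFin //; last 2 first.
  - by move=> x _; rewrite lee_fin.
  - exact/measurable_EFinP.
  rewrite -[leRHS]mule1; apply: lee_wpmul2l; first by rewrite lee_fin.
  by have [_ _ /(_ P HP)] := evE k; rewrite unlock.
by rewrite sumEFin -EFinD lee_fin /r subrK.
Qed.

(** * Necessity of the affine bound *)

Lemma emerging_affine_bound (R : realType) (K : nat) (F : K.-tuple R -> R) :
  nonneg_on_orthant F -> preserves_evariables F ->
  exists w : K.-tuple R,
    [/\ forall k : 'I_K, 0 <= tnth w k <= 1,
        \sum_(k < K) tnth w k <= 1 &
        forall u : K.-tuple R, orthant u ->
          F u <= 1 + \sum_(k < K) tnth w k * (tnth u k - 1)].
Proof.
move=> F0 pF.
(* Cone elements are represented by finite lists of weighted points: concatenation gives sums, and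
   scaling the weights gives multiples. *)
pose C : set ('rV[R]_K * R) := [set p | exists s : seq (R * K.-tuple R),
  [/\ forall x, x \in s -> 0 <= x.1 /\ orthant x.2,
      p.1 = \row_k \sum_(x <- s) x.1 * (tnth x.2 k - 1) &
      p.2 = \sum_(x <- s) x.1 * (F x.2 - 1)]].
have C1 u : orthant u -> C (\row_k (tnth u k - 1), F u - 1).
  move=> ou; exists [:: (1, u)]; split => /=.
  - by move=> x /[!inE] /eqP ->.
  - by apply/rowP => k; rewrite !mxE big_seq1 mul1r.
  - by rewrite big_seq1 mul1r.
have [||||a|w hw] := @cone_support R K C.
- move=> p q [s [s0 -> ->]] [t [t0 -> ->]]; exists (s ++ t); split => /=.
  + by move=> x; rewrite mem_cat => /orP[/s0|/t0].
  + by apply/rowP => k; rewrite !mxE big_cat.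
  + by rewrite big_cat.
- move=> c p c0 [s [s0 -> ->]]; exists [seq (c * x.1, x.2) | x <- s]; split => /=.
  + by move=> _ /mapP[x /s0[x0 ox] ->]; rewrite mulr_ge0 // ltW.
  + apply/rowP => k; rewrite !mxE big_map mulr_sumr.
    by apply: eq_bigr => x _; rewrite mulrA.
  + by rewrite big_map mulr_sumr; apply: eq_bigr => x _; rewrite mulrA.
- move=> k; pose u := [tuple 1 + (i == k)%:R : R | i < K].
  exists (F u - 1).
  have -> : delta_mx 0 k = \row_i (tnth u i - 1).
    by apply/rowP => i; rewrite !mxE tnth_mktuple eqxx addrAC subrr add0r.
  by apply: C1 => i; rewrite tnth_mktuple addr_ge0.
- move=> k; pose u := [tuple 1 - (i == k)%:R : R | i < K].
  exists (F u - 1).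
  have -> : - delta_mx 0 k = \row_i (tnth u i - 1).
    by apply/rowP => i; rewrite !mxE tnth_mktuple eqxx addrAC subrr add0r.
  by apply: C1 => i; rewrite tnth_mktuple; case: eqP; rewrite ?subrr ?subr0.
- move=> [s [s0 /= cs ->]]; apply: emerging_conic_combination => // k.
  by move/rowP: cs => /(_ k); rewrite !mxE => <-.
have wF u : orthant u -> F u <= 1 + \sum_(k < K) w k * (tnth u k - 1).
  move=> /C1 /hw /=; rewrite lerBlDl.
  by under eq_bigr do rewrite mxE.
have w_ge0 k : 0 <= w k.
  rewrite leNgt; apply/negP => wk.
  (* The step [- 2 / w k] is positive and makes the affine bound equal to 1 - 2 = -1, against
     [F u >= 0]. *)
  pose u := [tuple 1 + (i == k)%:R * (- 2 / w k) | i < K].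
  have ou : orthant u.
    move=> i; rewrite tnth_mktuple addr_ge0 // mulr_ge0 //.
    by rewrite mulNr -mulrN -invrN divr_ge0 // oppr_ge0 ltW.
  have := le_trans (F0 u ou) (wF u ou).
  rewrite (bigD1 k) //= tnth_mktuple eqxx big1 => [|i /negbTE ik]; last first.
    by rewrite tnth_mktuple ik mul0r addr0 subrr mulr0.
  rewrite mul1r addr0 (addrC 1 (_ / _)) addrK mulrC divfK ?lt_eqF //; lra.
have w_le1 : \sum_k w k <= 1.
  pose u : K.-tuple R := [tuple 0 | i < K].
  have ou : orthant u by move=> i; rewrite tnth_mktuple.
  have := le_trans (F0 u ou) (wF u ou).
  under eq_bigr do rewrite tnth_mktuple sub0r mulrN1.
  by rewrite sumrN subr_ge0.
exists [tuple w k | k < K]; split => [k||u ou].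
- rewrite tnth_mktuple w_ge0 /=; apply: le_trans w_le1.
  by rewrite (bigD1 k) //= lerDl sumr_ge0.
- by under eq_bigr do rewrite tnth_mktuple.
- by under eq_bigr do rewrite tnth_mktuple; exact: wF.
Qed.

(** * The equivalence and the monotone dominating function *)

Theorem corollary1 (R : realType) (K : nat) (K_ge1 : (1 <= K)%N) :
  (forall F : K.-tuple R -> R,
     nonneg_on_orthant F -> borel_on_orthant F ->
     (generalised_emerging F <->
      exists w : K.-tuple R,
        [/\ forall k : 'I_K, 0 <= tnth w k <= 1,
            \sum_(k < K) tnth w k <= 1 &
            forall u : K.-tuple R, orthant u ->
              F u <= 1 + \sum_(k < K) tnth w k * (tnth u k - 1)]))
  /\
  (forall F : K.-tuple R -> R, generalised_emerging F ->
     exists G : K.-tuple R -> R,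
       emerging G /\ forall u : K.-tuple R, orthant u -> F u <= G u).
Proof.
split=> [F F0 mF|F [F0 mF pF]].
  split=> [[_ _ pF]|[w [w01 w1 Fw]]]; first exact: emerging_affine_bound.
  split=> //; apply: (affine_preserves_evariables F0 mF _ w1 Fw) => k.
  by have /andP[] := w01 k.
have [w [w01 w1 Fw]] := emerging_affine_bound F0 pF.
have w0 k : 0 <= tnth w k by have /andP[] := w01 k.
(* The affine bound itself serves as [G]: it is monotone because the slopes are non-negative, and
   non-negative on the orthant because it dominates [F] there. *)
pose G (u : K.-tuple R) := 1 + \sum_(k < K) tnth w k * (tnth u k - 1).
have G0 : nonneg_on_orthant G by move=> u ou; exact: le_trans (F0 u ou) (Fw u ou).
exists G; split=> //; split=> // [u v _ _ uv|].
  by rewrite lerD2l ler_sum // => k _; rewrite ler_wpM2l // lerB.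
apply: (affine_preserves_evariables (w := w)) => //.
apply: measurable_funTS; apply: measurable_funD => //.
apply: measurable_sum => k; apply: measurable_funM => //.
by apply: measurable_funB => //; exact: measurable_tnth.
Qed.
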